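(* Let $(X_n)_{n=1}^\infty$ be a sequence of Banach spaces (not necessarily separable) with uniformly summable Szlenk index. Then the $c_0$-direct sum $X=\bigl(\bigoplus_{n=1}^\infty X_n\bigr)_{c_0}$ has summable Szlenk index.
   Context: For a weak$^\ast$-compact subset $K$ of the dual $X^\ast$ of a Banach space $X$ and $\varepsilon>0$, the $\varepsilon$-Szlenk derivation is $$\iota_\varepsilon K=\{x^\ast\in K:\ \mathrm{diam}(K\cap U)>\varepsilon\text{ for every }w^\ast\text{-open neighborhood }U\text{ of }x^\ast\}.$$ $\iota_{\varepsilon_1}\ldots\iota_{\varepsilon_n}K$ denotes the composition $\iota_{\varepsilon_1}(\iota_{\varepsilon_2}(\cdots\iota_{\varepsilon_n}(K)\cdots))$. With $B_{X^\ast}$ the closed unit ball of $X^\ast$, the space $X$ has summable Szlenk index with constant $M$ if for all $n\in\mathbb{N}$ and all $\varepsilon_1,\ldots,\varepsilon_n>0$ one has $\sum_{i=1}^n\varepsilon_i\leq M$ whenever $\iota_{\varepsilon_1}\ldots\iota_{\varepsilon_n}B_{X^\ast}\neq\varnothing$; it has summable Szlenk index if it does so with some constant $M<\infty$. A family of Banach spaces has uniformly summable Szlenk index if all its members have summable Szlenk index with one and the same constant. The space $(\bigoplus_n X_n)_{c_0}$ consists of all sequences $(x_n)$ with $x_n\in X_n$ and $\|x_n\|\to0$, with norm $\sup_n\|x_n\|$. *)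

(* Defs.v *)
From HB Require Import structures.
From mathcomp Require Import all_boot all_order all_algebra.
From mathcomp Require Import all_classical all_reals all_analysis.

(* Banach spaces are over the real field: completeNormedModType R with
   R : realType. *)

Set Implicit Arguments.
Unset Strict Implicit.
Unset Printing Implicit Defensive.

Import Order.TTheory GRing.Theory Num.Theory.
Import numFieldNormedType.Exports.

Local Open Scope classical_set_scope.
Local Open Scope ring_scope.

Section dual.
Context {R : realType} (X : normedModType R).

Definition dual_pred : {pred X -> R} :=
  [pred f : X -> R | `[< linear f /\ continuous f >]].

Record dual := Dual { dual_fun :> X -> R ; _ : dual_fun \in dual_pred }.

HB.instance Definition _ := [isSub for dual_fun].
HB.instance Definition _ := [Choice of dual by <:].

Lemma dualP (f : dual) : linear f /\ continuous f.
Proof. by case: f => f fP; exact/asboolP. Qed.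

Fact dual_submod_closed : GRing.submod_closed dual_pred.
Proof.
split.
  apply/asboolP; split=> [a u v|x]; first by rewrite scaler0 addr0.
  exact: cvg_cst.
move=> a f g /asboolP[fl fc] /asboolP[gl gc]; apply/asboolP; split.
  move=> b u v; rewrite !fctE fl gl.
  by rewrite !scalerDr !scalerA (mulrC a b) addrACA.
move=> x; apply: cvgD; last exact: gc.
by apply: cvgZr; exact: fc.
Qed.

HB.instance Definition _ :=
  GRing.isSubmodClosed.Build R (X -> R) dual_pred dual_submod_closed.
HB.instance Definition _ := [SubChoice_isSubLmodule of dual by <:].

Definition dual_norm (f : dual) : R :=
  sup [set `|f x| | x in [set x : X | `|x| <= 1]].

Let dual_has_sup (f : dual) :
  has_sup [set `|f x| | x in [set x : X | `|x| <= 1]].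
Proof.
split; first by exists `|f 0|, 0 => //=; rewrite normr0.
have [fl fc] := dualP f.
pose g : {linear X -> R} :=
  HB.pack (dual_fun f) (GRing.isLinear.Build _ _ _ _ _ fl).
have /bounded_funP/(_ 1)[M gM] : bounded_near g (nbhs (0 : X)).
  exact/linear_bounded_continuous.
by exists M => _ [x /= x1 <-]; exact: gM.
Qed.

Let dual0 (f : dual) : f 0 = 0.
Proof.
have := (dualP f).1 1 0 0; rewrite !scale1r addr0 => /eqP.
by rewrite -subr_eq0 opprD addrA subrr sub0r oppr_eq0 => /eqP.
Qed.

Let dualZ (f : dual) a x : f (a *: x) = a *: f x.
Proof. by have := (dualP f).1 a x 0; rewrite !addr0 dual0 addr0. Qed.

Let dual_norm_ub (f : dual) x : `|x| <= 1 -> `|f x| <= dual_norm f.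
Proof. by move=> x1; apply: ub_le_sup; [case: (dual_has_sup f)|exists x]. Qed.

Let dual_norm_le (f : dual) M :
  (forall x, `|x| <= 1 -> `|f x| <= M) -> dual_norm f <= M.
Proof.
move=> fM; apply: ge_sup; first by case: (dual_has_sup f).
by move=> _ [x /= x1 <-]; exact: fM.
Qed.

Let dual_normD f g : dual_norm (f + g) <= dual_norm f + dual_norm g.
Proof.
apply: dual_norm_le => x x1; rewrite (le_trans (ler_normD _ _))//.
by rewrite lerD ?dual_norm_ub.
Qed.

Let dual_normZ_le a f : dual_norm (a *: f) <= `|a| * dual_norm f.
Proof.
by apply: dual_norm_le => x x1; rewrite normrM ler_wpM2l ?dual_norm_ub.
Qed.

Let dual_normZ (a : R) f : dual_norm (a *: f) = `|a| * dual_norm f.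
Proof.
apply/eqP; rewrite eq_le dual_normZ_le /=.
have [->|a0] := eqVneq a 0.
  by rewrite normr0 mul0r (le_trans _ (@dual_norm_ub _ 0 _)) ?normr0.
rewrite -ler_pdivlMl ?normr_gt0// -normfV.
by rewrite -[in leLHS](scalerK a0 f) dual_normZ_le.
Qed.

Let dual_norm0_eq0 f : dual_norm f = 0 -> f = 0.
Proof.
move=> f0; apply/val_inj/funext => x /=.
have [->|x0] := eqVneq x 0; first by rewrite dual0.
have : `|f (`|x|^-1 *: x)| <= dual_norm f.
  by apply: dual_norm_ub; rewrite normrZV// unitfE normr_eq0.
rewrite f0 normr_le0 dualZ => /eqP/(congr1 (fun z => `|x| *: z)).
by rewrite scalerA divff ?normr_eq0// scale1r scaler0.
Qed.

HB.instance Definition _ := @Lmodule_isNormed.Build R dual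
  dual_norm dual_normD dual_normZ dual_norm0_eq0.

(* [dual] itself carries the topology of the dual norm; [weak_star] is the same
   type with the topology of pointwise convergence on X. *)
Definition weak_star : Type :=
  initial_topology (dual_fun : dual -> {ptws X -> R}).
HB.instance Definition _ := Topological.on weak_star.

End dual.

Section szlenk.
Context {R : realType}.

(* Extended-real valued, so that unbounded sets have diameter +oo. *)
Definition diam (V : normedModType R) (A : set V) : \bar R :=
  ereal_sup [set (`|x - y|)%:E | x in A & y in A].

(* Defined for every K; the notion is used for weak*-compact K only. *)
Definition szlenk_derivation (X : normedModType R) (eps : R)
    (K : set (dual X)) : set (dual X) :=
  [set f | K f /\ forall U : set (weak_star X), open U -> U f ->
                    (eps%:E < diam (K `&` U : set (dual X)))%E].

Definition dual_unit_ball (X : normedModType R) : set (dual X) :=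
  [set f | `|f| <= 1].

(* The first entry of eps is the parameter of the outermost derivation. *)
Definition iter_szlenk_derivation (X : normedModType R) n (eps : n.-tuple R)
    (K : set (dual X)) : set (dual X) :=
  foldr (@szlenk_derivation X) K eps.

Definition summable_szlenk_with (X : completeNormedModType R) (M : R) : Prop :=
  forall n (eps : n.-tuple R), (0 < n)%N -> (forall i, 0 < tnth eps i) ->
    iter_szlenk_derivation eps (@dual_unit_ball X) !=set0 ->
    \sum_(i < n) tnth eps i <= M.

Definition summable_szlenk (X : completeNormedModType R) : Prop :=
  exists M : R, summable_szlenk_with X M.

Definition uniformly_summable_szlenk (I : Type)
    (X : I -> completeNormedModType R) : Prop :=
  exists M : R, forall i, summable_szlenk_with (X i) M.

End szlenk.

Section c0_sum.
Context {R : realType} (X : nat -> completeNormedModType R).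

Record c0_sum := C0Sum {
  c0_seq :> forall n, X n ;
  c0_cvg0 : `|c0_seq n| @[n --> \oo] --> (0 : R) }.

HB.instance Definition _ := gen_eqMixin c0_sum.
HB.instance Definition _ := gen_choiceMixin c0_sum.

Lemma c0_sum_ext (x y : c0_sum) : (forall n, x n = y n) -> x = y.
Proof.
case: x y => [x xP] [y yP] /= xy.
have {}xy : x = y by exact: functional_extensionality_dep.
by rewrite -{}xy in yP *; congr C0Sum; exact: Prop_irrelevance.
Qed.

Let cvg0_le (u v : nat -> R) : (forall n, `|u n| <= v n) ->
  v @ \oo --> (0 : R) -> u @ \oo --> (0 : R).
Proof.
move=> uv v0; apply: norm_cvg0.
apply: (@squeeze_cvgr _ _ _ _ (cst 0) v) => //; last exact: cvg_cst.
by apply: nearW => n /=; rewrite normr_ge0 uv.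
Qed.

Let c0_zero_cvg0 : `|(0 : X n)| @[n --> \oo] --> (0 : R).
Proof. by under eq_fun do rewrite normr0; exact: cvg_cst. Qed.

Let c0_opp_cvg0 (x : c0_sum) : `|- x n| @[n --> \oo] --> (0 : R).
Proof. by under eq_fun do rewrite normrN; exact: c0_cvg0. Qed.

Let c0_add_cvg0 (x y : c0_sum) : `|x n + y n| @[n --> \oo] --> (0 : R).
Proof.
apply: (@cvg0_le _ (fun n => `|x n| + `|y n|)) => [n|].
  by rewrite normr_id ler_normD.
by have := cvgD (c0_cvg0 x) (c0_cvg0 y); rewrite addr0; exact.
Qed.

Let c0_scale_cvg0 (a : R) (x : c0_sum) : `|a *: x n| @[n --> \oo] --> (0 : R).
Proof.
under eq_fun do rewrite normrZ.
by have := cvgM (cvg_cst `|a|) (c0_cvg0 x); rewrite mulr0; exact.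
Qed.

Definition c0_zero := C0Sum c0_zero_cvg0.
Definition c0_opp x := C0Sum (c0_opp_cvg0 x).
Definition c0_add x y := C0Sum (c0_add_cvg0 x y).
Definition c0_scale a x := C0Sum (c0_scale_cvg0 a x).

Let c0_addA : associative c0_add.
Proof. by move=> x y z; apply: c0_sum_ext => n /=; rewrite addrA. Qed.

Let c0_addC : commutative c0_add.
Proof. by move=> x y; apply: c0_sum_ext => n /=; rewrite addrC. Qed.

Let c0_add0 : left_id c0_zero c0_add.
Proof. by move=> x; apply: c0_sum_ext => n /=; rewrite add0r. Qed.

Let c0_addN : left_inverse c0_zero c0_opp c0_add.
Proof. by move=> x; apply: c0_sum_ext => n /=; rewrite addNr. Qed.

HB.instance Definition _ :=
  GRing.isZmodule.Build c0_sum c0_addA c0_addC c0_add0 c0_addN.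

Let c0_scaleA a b x : c0_scale a (c0_scale b x) = c0_scale (a * b) x.
Proof. by apply: c0_sum_ext => n /=; rewrite scalerA. Qed.

Let c0_scale1 : left_id 1 c0_scale.
Proof. by move=> x; apply: c0_sum_ext => n /=; rewrite scale1r. Qed.

Let c0_scaleDr : right_distributive c0_scale +%R.
Proof. by move=> a x y; apply: c0_sum_ext => n /=; rewrite scalerDr. Qed.

Let c0_scaleDl x : {morph c0_scale^~ x : a b / a + b}.
Proof. by move=> a b; apply: c0_sum_ext => n /=; rewrite scalerDl. Qed.

HB.instance Definition _ := GRing.Zmodule_isLmodule.Build R c0_sum
  c0_scaleA c0_scale1 c0_scaleDr c0_scaleDl.

Definition c0_norm (x : c0_sum) : R := sup (range (fun n => `|x n|)).

Let c0_has_sup (x : c0_sum) : has_sup (range (fun n => `|x n|)).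
Proof.
split; first by exists `|x 0|, 0%N.
have /cvg_seq_bounded[M [_ xM]] : cvgn (fun n => `|x n|).
  by apply/cvg_ex; exists 0; exact: c0_cvg0.
exists (M + 1) => _ [n _ <-].
have M1 : M < M + 1 by rewrite ltrDl.
by have := xM _ M1 n Logic.I; rewrite /= normr_id.
Qed.

Lemma c0_norm_ub (x : c0_sum) n : `|x n| <= c0_norm x.
Proof. by apply: ub_le_sup; [case: (c0_has_sup x)|exists n]. Qed.

Lemma c0_norm_le (x : c0_sum) M : (forall n, `|x n| <= M) -> c0_norm x <= M.
Proof.
by move=> xM; apply: ge_sup; [case: (c0_has_sup x)|move=> _ [n _ <-]; exact: xM].
Qed.

Let c0_normD x y : c0_norm (x + y) <= c0_norm x + c0_norm y.
Proof.
apply: c0_norm_le => n; rewrite (le_trans (ler_normD _ _))//.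
by rewrite lerD ?c0_norm_ub.
Qed.

Let c0_normZ_le a x : c0_norm (a *: x) <= `|a| * c0_norm x.
Proof. by apply: c0_norm_le => n; rewrite normrZ ler_wpM2l ?c0_norm_ub. Qed.

Let c0_normZ (a : R) x : c0_norm (a *: x) = `|a| * c0_norm x.
Proof.
apply/eqP; rewrite eq_le c0_normZ_le /=.
have [->|a0] := eqVneq a 0.
  by rewrite normr0 mul0r (le_trans _ (c0_norm_ub _ 0)).
rewrite -ler_pdivlMl ?normr_gt0// -normfV.
by rewrite -[in leLHS](scalerK a0 x) c0_normZ_le.
Qed.

Let c0_norm0_eq0 x : c0_norm x = 0 -> x = 0.
Proof.
move=> x0; apply: c0_sum_ext => n; apply/eqP.
by rewrite -normr_le0 -x0 c0_norm_ub.
Qed.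

HB.instance Definition _ := @Lmodule_isNormed.Build R c0_sum
  c0_norm c0_normD c0_normZ c0_norm0_eq0.

Let c0_complete (F : set_system c0_sum) : ProperFilter F -> cauchy F -> cvg F.
Proof.
move=> FF /cauchy_ballP Fc.
have Fn n : cvg ((fun x : c0_sum => x n) @ F).
  apply: cauchy_cvg; apply/cauchy_ballP => e e0.
  rewrite near_map2.
  have := Fc _ e0; apply: filterS => -[x y] /=; rewrite -!ball_normE /= => xy.
  exact: le_lt_trans (c0_norm_ub (x - y) n) xy.
pose y n : X n := lim ((fun x : c0_sum => x n) @ F).
have yP (e : R) : 0 < e ->
    \forall x \near F, forall n, `|(x : c0_sum) n - y n| <= e.
  move=> e0; have /nearP_dep := Fc _ e0; apply: filterS => x xF n.
  apply/ler_addgt0Pr => d d0; near F => z.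
  rewrite (le_trans (ler_distD (z n) _ _))// lerD//.
    have : ball x e z by near: z; exact: xF.
    by rewrite -ball_normE /= => /ltW; exact: le_trans (c0_norm_ub (x - z) n).
  near: z; move/cvgrPdist_le : (Fn n) => /(_ d d0).
  by under eq_near do rewrite distrC.
have y0 : `|y n| @[n --> \oo] --> (0 : R).
  apply/cvgrPdist_le => e e0; near F => x.
  have xy : forall n, `|x n - y n| <= e / 2.
    by near: x; apply: yP; rewrite divr_gt0.
  have /cvgrPdist_le/(_ (e / 2)) := c0_cvg0 x.
  rewrite divr_gt0// => /(_ isT); apply: filterS => n.
  rewrite !sub0r !normrN !normr_id => xn.
  rewrite -(subKr (x n) (y n)) (le_trans (ler_normB _ _))//.
  by rewrite (splitr e) lerD.
apply/cvg_ex; exists (C0Sum y0); apply/cvgrPdist_le => e e0.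
apply: filterS (yP _ e0) => x xy; rewrite distrC.
exact: c0_norm_le.
Unshelve. all: by end_near. Qed.

HB.instance Definition _ := Uniform_isComplete.Build c0_sum c0_complete.

End c0_sum.

(* Main.v *)
Require Import Defs.
From HB Require Import structures.
From mathcomp Require Import all_boot all_order all_algebra.
From mathcomp Require Import all_classical all_reals all_analysis.
From mathcomp Require Import lra ring zify.
Import numFieldNormedType.Exports.

Set Implicit Arguments.
Unset Strict Implicit.
Unset Printing Implicit Defensive.

Import Order.TTheory GRing.Theory Num.Theory.

Local Open Scope classical_set_scope.
Local Open Scope ring_scope.

(** For a space with summable Szlenk constant [M], call [C t - sum eps_i], with
    [C = M + 1], the cost of a representation [f \in iota_eps (t B)], and let
    [P f] be the least cost.  Since [sum eps_i <= M t], [P] is comparable with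
    the norm.  A functional [f] that is the weak* limit of functionals [g] at
    distance more than [e] from [f] and of cost at most [p] lies in one more
    derivation, hence [P f <= p - e]; so [P g >= P f + `|g - f|] for [g] weak*
    close to [f].  This holds up to an error [d] when [t] and the [eps_i] are
    restricted to multiples of [d], which leaves finitely many closed sets
    [iota_eps (t B)] to consider.  The sum of the coordinate potentials has the
    same property on the dual of the c0-sum, where [`|g - f|] is the sum of
    the coordinate norms: finitely many coordinates are controlled by weak*
    closeness, and on the others [f] is negligible while
    [P (g n) >= `|g n|].  As each derivation makes [P] drop by about
    half its parameter and [P <= C] on the ball, the parameters have sum
    bounded by about [2 C]. *)

(** * Dual functionals and the weak* topology *)

Section dual_theory.
Context {R : realType} (X : normedModType R).
Implicit Types (f g : dual X) (x y : X).

Lemma dual_funD f x y : f (x + y) = f x + f y.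
Proof. by have := (dualP f).1 1 x y; rewrite !scale1r. Qed.

Lemma dual_fun0 f : f 0 = 0.
Proof. by apply: (addrI (f 0)); rewrite -dual_funD !addr0. Qed.

Lemma dual_funZ f a x : f (a *: x) = a * f x.
Proof. by have := (dualP f).1 a x 0; rewrite !addr0 dual_fun0 addr0. Qed.

Lemma dual_fun_sum f (u : nat -> X) k :
  f (\sum_(n < k) u n) = \sum_(n < k) f (u n).
Proof. exact: (big_morph _ (dual_funD f) (dual_fun0 f)). Qed.

Lemma dual_has_sup f : has_sup [set `|f x| | x in [set x : X | `|x| <= 1]].
Proof.
split; first by exists `|f 0|, 0 => //=; rewrite normr0.
have [fl fc] := dualP f.
pose g : {linear X -> R} :=
  HB.pack (dual_fun f) (GRing.isLinear.Build _ _ _ _ _ fl).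
have /bounded_funP/(_ 1)[M gM] : bounded_near g (nbhs (0 : X)).
  exact/linear_bounded_continuous.
by exists M => _ [x /= x1 <-]; exact: gM.
Qed.

Lemma dual_ler_norm f x : `|f x| <= `|f| * `|x|.
Proof.
have [->|x0] := eqVneq x 0; first by rewrite dual_fun0 !normr0 mulr0.
have nx0 : 0 < `|x| by rewrite normr_gt0.
rewrite -ler_pdivrMr// mulrC.
have -> : `|x|^-1 * `|f x| = `|f (`|x|^-1 *: x)|.
  by rewrite dual_funZ normrM ger0_norm// invr_ge0 ltW.
apply: ub_le_sup; first by case: (dual_has_sup f).
by exists (`|x|^-1 *: x) => //=; rewrite normrZV// unitfE normr_eq0.
Qed.

Lemma dual_norm_le f M : (forall x, `|x| <= 1 -> `|f x| <= M) -> `|f| <= M.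
Proof.
move=> fM; apply: ge_sup; first by case: (dual_has_sup f).
by move=> _ [x /= x1 <-]; exact: fM.
Qed.

Lemma dual_norm_approx f e : 0 < e -> exists2 x, `|x| <= 1 & `|f| - e < f x.
Proof.
move=> e0; have [_ [x /= x1 <-]] := sup_adherent e0 (dual_has_sup f).
have [fx0|fx0] := leP 0 (f x).
  by rewrite ger0_norm// => fx; exists x.
rewrite ltr0_norm// => fx; exists (- x); first by rewrite normrN.
by rewrite -(scaleN1r x) dual_funZ mulN1r.
Qed.

Lemma weak_star_eval_continuous x :
  continuous (fun g : weak_star X => (g : dual X) x).
Proof.
move=> f.
have fc := @initial_continuous _ {ptws X -> R} (@dual_fun R X) f.
have pc := @proj_continuous X (fun=> R) x (f : X -> R).
exact: (@continuous_comp (weak_star X) {ptws X -> R} R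
  (@dual_fun R X) (proj x) f fc pc).
Qed.

Lemma continuous_weak_star (T : topologicalType) (phi : T -> dual X) :
  (forall x, continuous (fun t => phi t x)) ->
  continuous (phi : T -> weak_star X).
Proof.
move=> phic; apply: continuous_comp_initial => t.
suff : {ptws, (fun t => phi t : X -> R) @ t --> (phi t : X -> R)} by exact.
by apply/pointwise_cvgP => x; exact: phic.
Qed.

Lemma closed_dual_ball r : 0 <= r ->
  closed ([set f | `|f| <= r] : set (weak_star X)).
Proof.
move=> r0.
have -> : ([set f | `|f| <= r] : set (weak_star X)) =
    \bigcap_(x in [set x : X | `|x| <= 1]) [set f | `|f x| <= r].
  apply/seteqP; split => f /= fr.
    move=> x /= x1; rewrite (le_trans (dual_ler_norm _ _))// -[r]mulr1.
    exact: ler_pM.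
  by apply: dual_norm_le => x /fr.
apply: closed_bigI => x _.
apply: (@preimage_closed _ _ (fun f : weak_star X => `|(f : dual X) x|)
  [set y | y <= r]).
  by move=> f _; exact: cvg_norm (@weak_star_eval_continuous x f).
exact: closed_le.
Qed.

End dual_theory.

(** * Szlenk derivations: monotonicity, closedness, scaling *)

Notation iter_szlenk := (foldr (@szlenk_derivation _ _)).

Section szlenk_theory.
Context {R : realType} (X : normedModType R).
Implicit Types (f g : dual X) (K : set (dual X)) (s : seq R) (e t : R).

Lemma diam_gtP (A : set (dual X)) e :
  (e%:E < diam A)%E <-> exists f g, [/\ A f, A g & e < `|f - g|].
Proof.
split.
  move=> /ereal_sup_gt[_ [f Af [g Ag <-]]]; rewrite lte_fin => efg.
  by exists f, g.
move=> [f [g [Af Ag efg]]]; apply/ereal_sup_gtP.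
by exists `|f - g|%:E; rewrite ?lte_fin//; exists f => //; exists g.
Qed.

Lemma szlenk_derivation_subset e K : szlenk_derivation e K `<=` K.
Proof. by move=> f []. Qed.

Lemma szlenk_derivationS e K K' :
  K `<=` K' -> szlenk_derivation e K `<=` szlenk_derivation e K'.
Proof.
move=> KK' f [Kf Uf]; split; first exact: KK'.
move=> U Uo /(Uf _ Uo)/diam_gtP[g [h [[Kg Ug] [Kh Uh] egh]]].
by apply/diam_gtP; exists g, h; split=> //; split=> //; exact: KK'.
Qed.

Lemma iter_szlenk_subset K s : iter_szlenk K s `<=` K.
Proof.
elim: s => [//|e s ih] f /=; move=> /szlenk_derivation_subset; exact: ih.
Qed.

(** Two points at distance more than [e] cannot both lie within [e / 2] of [f]. *)
Lemma szlenk_derivation_far e K f (A : set (weak_star X)) :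
  szlenk_derivation e K f -> nbhs (f : weak_star X) A ->
  exists g, [/\ K g, A g & e / 2 < `|g - f|].
Proof.
move=> [Kf Uf]; rewrite nbhsE => -[U [Uo fU] UA].
have /diam_gtP[g [h [[Kg Ug] [Kh Uh] egh]]] := Uf _ Uo fU.
have [eg|ge] := ltP (e / 2) `|g - f|.
  by exists g; split => //; exact: UA.
exists h; split => //; first exact: UA.
have := ler_distD f g h; rewrite (distrC f h) => ghf.
rewrite -(ltrD2l (e / 2)) -splitr (lt_le_trans egh)// (le_trans ghf)//.
by rewrite lerD2r.
Qed.

(** A partial converse: [f] itself serves as one of the two distant points, so no factor 2 is
    lost. *)
Lemma far_szlenk_derivation e K f : K f ->
  (forall A : set (weak_star X), nbhs (f : weak_star X) A ->
    exists g, [/\ K g, A g & e < `|g - f|]) ->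
  szlenk_derivation e K f.
Proof.
move=> Kf far; split => // U Uo Uf; apply/diam_gtP.
have [g [Kg Ug egf]] := far U (open_nbhs_nbhs (conj Uo Uf)).
by exists g, f.
Qed.

(** An open neighbourhood of a limit point is also a neighbourhood of some point of the derived
    set. *)
Lemma closed_szlenk_derivation e K : closed (K : set (weak_star X)) ->
  closed (szlenk_derivation e K : set (weak_star X)).
Proof.
move=> Kc f fcl; split.
  by apply: Kc => A /fcl[g [/szlenk_derivation_subset Kg Ag]]; exists g.
move=> U Uo Uf; have [g [[Kg Ug] Ug']] := fcl U (open_nbhs_nbhs (conj Uo Uf)).
exact: Ug.
Qed.

Lemma closed_iter_szlenk K s : closed (K : set (weak_star X)) ->
  closed (iter_szlenk K s : set (weak_star X)).
Proof. by move=> Kc; elim: s => //= e s; exact: closed_szlenk_derivation. Qed.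

Lemma weak_star_scale_continuous t :
  continuous ((fun f => t *: f : dual X) : weak_star X -> weak_star X).
Proof.
apply: continuous_weak_star => x f.
exact: (cvgM (cvg_cst t) (@weak_star_eval_continuous _ _ x f)).
Qed.

Lemma szlenk_derivation_scale t e K f : 0 < t ->
  szlenk_derivation e [set g | K (t^-1 *: g)] f ->
  szlenk_derivation (e / t) K (t^-1 *: f).
Proof.
move=> t0 [Kf Uf]; split => // U Uo Ufs.
pose V : set (weak_star X) := [set g : dual X | U (t^-1 *: g)].
have Vo : open V.
  have /continuousP := @weak_star_scale_continuous t^-1; exact.
have /diam_gtP[g [h [[Kg Vg] [Kh Vh] egh]]] := Uf V Vo Ufs.
apply/diam_gtP; exists (t^-1 *: g), (t^-1 *: h); split=> //.
by rewrite -scalerBr normrZ gtr0_norm ?invr_gt0// mulrC ltr_pM2l ?invr_gt0.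
Qed.

Lemma iter_szlenk_scale t s f : 0 < t ->
  iter_szlenk [set g | `|g| <= t] s f ->
  iter_szlenk (@dual_unit_ball R X) [seq e / t | e <- s] (t^-1 *: f).
Proof.
move=> t0; elim: s f => [|e s ih] f /=.
  move=> ft; rewrite /dual_unit_ball/= normrZ gtr0_norm ?invr_gt0//.
  by rewrite ler_pdivrMl// mulr1.
move=> fe; apply: szlenk_derivation_scale => //.
by move: fe; apply: szlenk_derivationS => g; exact: ih.
Qed.

End szlenk_theory.

Lemma summable_szlenk_ball (R : realType) (X : completeNormedModType R)
    (M t : R) (s : seq R) (f : dual X) :
  summable_szlenk_with X M -> 0 <= M -> 0 < t -> {in s, forall e, 0 < e} ->
  iter_szlenk [set g | `|g| <= t] s f -> \sum_(e <- s) e <= M * t.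
Proof.
move=> XM M0 t0 s0 /(iter_szlenk_scale t0) ft.
(* Summability speaks of nonempty tuples only; for the empty list the bound follows from
   [0 <= M]. *)
have [->|sN] := eqVneq s [::].
  by rewrite big_nil mulr_ge0// ltW.
rewrite -ler_pdivrMr// mulr_suml -(big_map (fun e => e / t) xpredT id).
rewrite big_tnth; apply: (XM _ (in_tuple [seq e / t | e <- s])).
- by rewrite size_map; case: s sN {s0 ft}.
- move=> i; have /mapP[e es ->] := mem_tnth i (in_tuple [seq e / t | e <- s]).
  by rewrite divr_gt0// s0.
- by exists (t^-1 *: f).
Qed.

(** Only finitely many lists of positive integers have sum at most [k], so their conditions hold
    simultaneously near the limit. *)
Lemma near_bounded_sumn (T : Type) (F : set_system T) (E : seq nat -> T -> Prop)
    k : Filter F ->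
  (forall s, all (leq 1) s -> (sumn s <= k)%N -> \forall x \near F, E s x) ->
  \forall x \near F, forall s, all (leq 1) s -> (sumn s <= k)%N -> E s x.
Proof.
move=> FF; elim: k E => [|k ih] E FE.
  apply: filterS (FE [::] isT isT) => x Ex [//|m s] /= /andP[m0 _].
  by rewrite leqn0 addn_eq0 => /andP[/eqP m0']; rewrite m0' in m0.
(* A positive head leaves a tail of sum at most [k], where the induction hypothesis applies, and
   only finitely many heads occur. *)
have Fcons : \forall x \near F, forall (i : 'I_k.+1) s, all (leq 1) s ->
    (sumn s <= k)%N -> (sumn (i.+1 :: s) <= k.+1)%N -> E (i.+1 :: s) x.
  apply: filter_forall => i; apply: ih => s s1 sk.
  have [isk|_] := boolP (sumn (i.+1 :: s) <= k.+1)%N; last exact: filterE.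
  by have := FE (i.+1 :: s) s1 isk; apply: filterS => x Ex _.
apply: filterS2 (FE [::] isT isT) Fcons => x E0 Ex [//|[//|m] s] /= s1 sk.
have mk : (m < k.+1)%N by lia.
by apply: (Ex (Ordinal mk) s s1) => //=; lia.
Qed.

(** * The potential on the dual of a single space *)

Section potential.
Context {R : realType} (X : completeNormedModType R) (M : nat) (d : R).
Hypotheses (XM : summable_szlenk_with X M%:R) (d0 : 0 < d).
Implicit Types (f g : dual X) (a p m : nat) (s : seq nat).

Let L a s : set (dual X) :=
  iter_szlenk [set g | `|g| <= a%:R * d] [seq m%:R * d | m <- s].

(* [f] has a representation of cost [p], in units of [d]. *)
Let level f p := exists a s,
  [/\ (0 < a)%N, all (leq 1) s, L a s f & (M.+1 * a = p + sumn s)%N].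

Let sumn_le a s f : (0 < a)%N -> all (leq 1) s -> L a s f ->
  (sumn s <= M * a)%N.
Proof.
move=> a0 /allP s1 Lf.
have := summable_szlenk_ball XM (ler0n _ _) _ _ Lf.
rewrite mulr_gt0 ?ltr0n// => /(_ isT) H.
have {}H : \sum_(e <- [seq m%:R * d | m <- s]) e <= M%:R * (a%:R * d).
  by apply: H => _ /mapP[m ms ->]; rewrite mulr_gt0// ltr0n s1.
move: H; rewrite big_map -mulr_suml -natr_sum mulrA ler_pM2r//.
by rewrite -natrM ler_nat -sumnE.
Qed.

(** No derivation is used; the radius is the least multiple of [d] exceeding [|f|]. *)
Let level_ex f : exists2 p, level f p & p%:R * d <= M.+1%:R * (`|f| + d).
Proof.
have fd0 : 0 <= `|f| / d by rewrite divr_ge0// ltW.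
have /andP[t1 t2] := truncn_itv fd0.
exists (M.+1 * (Num.truncn (`|f| / d)).+1)%N.
  exists (Num.truncn (`|f| / d)).+1, [::]; split => //; last by rewrite addn0.
  by rewrite /L/= -ler_pdivrMr// ltW.
rewrite natrM -mulrA ler_pM2l ?ltr0n//.
rewrite -(ler_pM2r d0) divfK ?gt_eqF// in t1.
by rewrite -natr1 mulrDl mul1r lerD2r.
Qed.

(** The extra 1 in [M.+1] gives [a <= p], while [f] lies in the ball of radius [a%:R * d]. *)
Let level_norm f p : level f p -> `|f| <= p%:R * d.
Proof.
move=> [a [s [a0 s1 Lf E]]]; have sM := sumn_le a0 s1 Lf.
apply: (le_trans (iter_szlenk_subset Lf)).
by rewrite ler_pM2r// ler_nat; lia.
Qed.

Let level_near f p : (forall q, level f q -> (p <= q)%N) ->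
  forall r, \forall g \near (f : weak_star X), forall q,
    `|g : dual X| <= r -> level g q -> (q%:R * d <= r) ->
    p%:R * d + `|(g : dual X) - f| <= q%:R * d + d.
Proof.
move=> pmin r.
(* A cost [q] is at least its radius [a], so [q%:R * d <= r] leaves only the radii below [n]. *)
have [n rn] : exists n, r < n%:R * d.
  by exists (Num.truncn (r / d)).+1; rewrite -ltr_pdivrMr// truncnS_gt.
have FF : Filter (nbhs (f : weak_star X)).
  exact: nbhs_filter (f : weak_star X).
pose E (a : 'I_n) s (g : dual X) := (0 < a)%N -> L a s g ->
  p%:R * d + `|g - f| <= (M.+1 * a - sumn s)%:R * d + d.
have Enear (a : 'I_n) : \forall g \near (f : weak_star X), forall s,
    all (leq 1) s -> (sumn s <= M * a)%N -> E a s g.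
  apply: (@near_bounded_sumn (weak_star X) _ (E a) _ FF) => s s1 sM; rewrite /E.
  have [a0|] := boolP (0 < a)%N; last by move=> _; exact: filterE.
  have Lc : closed (L a s : set (weak_star X)).
    apply: closed_iter_szlenk; apply: closed_dual_ball.
    by rewrite mulr_ge0// ltW.
  (* If [f] is outside the closed set [L a s], so are all nearby [g], and [E a s g] is vacuous. *)
  have [Lf|nLf] := pselect (L a s f); last first.
    apply: filterS (_ : nbhs (f : weak_star X) (~` L a s)).
      by move=> g nLg _ Lg; case: nLg.
    exact: (open_nbhs_nbhs (conj (closed_openC Lc) nLf)).
  have pq : (p <= M.+1 * a - sumn s)%N.
    by apply: pmin; exists a, s; split => //; lia.
  set q := (M.+1 * a - sumn s)%N in pq *.
  (* [q] is also a cost of [f]; the successor in [(q - p).+1] accounts for the error [d] in the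
     estimate. *)
  have [h|h] := pselect (\forall g \near (f : weak_star X),
      L a s g -> `|(g : dual X) - f| <= (q - p).+1%:R * d).
    apply: filterS h => g h _ /h gf.
    rewrite (le_trans (lerD (lexx _) gf))// -mulrDl -{3}(mul1r d) -mulrDl.
    rewrite ler_pM2r// -natrD natr1 ler_nat; lia.
  (* One more derivation, by [(q - p).+1 * d], would give [f] the cost
     [p.-1]. *)
  exfalso.
  have Lf' : L a ((q - p).+1 :: s) f.
    apply: far_szlenk_derivation => // A fA.
    apply: contrapT => nA; apply: h; apply: filterS fA => g Ag Lg.
    rewrite leNgt; apply/negP => far; apply: nA; by exists g.
  (* This bound forces [p] to be positive, so that [p.-1] is really smaller. *)
  have sM' : ((q - p).+1 + sumn s <= M * a)%N by exact: (sumn_le a0 _ Lf').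
  have : (p <= p.-1)%N.
    apply: pmin; exists a, ((q - p).+1 :: s); split => //=; lia.
  lia.
have := @filter_forall (weak_star X) _ _ _ FF Enear.
apply: filterS => g H q gr [a [s [a0 s1 Lg qE]]] qr.
have sM := sumn_le a0 s1 Lg.
have an : (a < n)%N.
  rewrite -(ltr_nat R) -(ltr_pM2r d0) (le_lt_trans _ rn)// (le_trans _ qr)//.
  by rewrite ler_pM2r// ler_nat; lia.
have := H (Ordinal an) s s1 sM a0 Lg.
by rewrite /= qE addnK.
Qed.

Lemma szlenk_potential : exists P : dual X -> R,
  [/\ forall f, `|f| <= P f,
      forall f, P f <= M.+1%:R * (`|f| + d) &
      forall f r, \forall g \near (f : weak_star X),
        `|g : dual X| <= r -> P f + `|(g : dual X) - f| <= P g + d].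
Proof.
have /choice[P PP] : forall f, exists p,
    level f p /\ forall q, level f q -> (p <= q)%N.
  move=> f; have [p fp _] := level_ex f.
  have ex : exists p, `[< level f p >] by exists p; exact/asboolP.
  case: (ex_minnP ex) => q /asboolP fq qmin; exists q; split => // q' fq'.
  by apply: qmin; exact/asboolP.
have Ple f : (P f)%:R * d <= M.+1%:R * (`|f| + d).
  have [p fp] := level_ex f; apply: le_trans.
  by rewrite ler_pM2r// ler_nat (PP f).2.
exists (fun f => (P f)%:R * d); split => // [f|f r].
  exact: level_norm (PP f).1.
(* This radius dominates both [|g|] and, through [Ple], the cost of [g]; [r] may be negative, hence
   [|r|]. *)
have := level_near (PP f).2 (M.+1%:R * (`|r| + d)).
apply: filterS => g H gr; apply: H (PP g).1 _.
- apply: (le_trans gr); rewrite (le_trans (ler_norm r))//.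
  rewrite -[leLHS]mul1r ler_pM ?ler1n//.
  by rewrite lerDl ltW.
- rewrite (le_trans (Ple g))// ler_pM2l// lerD2r (le_trans gr)//.
  exact: ler_norm.
Qed.

End potential.

(** * The dual of the c0-sum, normed as the l1-sum of the duals *)

Section c0_sum_dual.
Context {R : realType} (X : nat -> completeNormedModType R).
Implicit Types (n k : nat) (f g : dual (c0_sum X)).

Let c0_inj_cvg0 n (x : X n) :
  `|eqtype.dfwith (fun k => 0 : X k) x k| @[k --> \oo] --> (0 : R).
Proof.
apply: cvg_near_cst; exists n.+1 => // k /= nk.
by rewrite dfwith_out ?normr0// ltn_eqF.
Qed.

Lemma c0_seqD (x y : c0_sum X) n : (x + y) n = x n + y n.
Proof. by []. Qed.

Definition c0_inj n (x : X n) : c0_sum X := C0Sum (@c0_inj_cvg0 n x).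

Lemma c0_injP n a (x y : X n) : c0_inj (a *: x + y) = a *: c0_inj x + c0_inj y.
Proof.
apply: c0_sum_ext => k /=; have [nk|nk] := eqVneq n k.
  by subst k; rewrite !dfwith_in.
by rewrite !dfwith_out// scaler0 addr0.
Qed.

Lemma norm_c0_inj n (x : X n) : `|c0_inj x| <= `|x|.
Proof.
apply: c0_norm_le => k /=; have [nk|nk] := eqVneq n k.
  by subst k; rewrite dfwith_in.
by rewrite dfwith_out// normr0.
Qed.

Lemma c0_sum_inj (x : forall n, X n) k m :
  (\sum_(n < k) c0_inj (x n)) m = if (m < k)%N then x m else 0.
Proof.
elim: k => [|k ih]; first by rewrite big_ord0.
rewrite big_ord_recr c0_seqD ih /=.
have [mk|km|<-] := ltngtP m k.
- by rewrite leqW// dfwith_out ?addr0// gtn_eqF.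
- by rewrite ltnS leqNgt km/= dfwith_out ?addr0// ltn_eqF.
- by rewrite ltnSn dfwith_in add0r.
Qed.

Let c0_inj_continuous n : continuous (@c0_inj n).
Proof.
move=> x; apply/cvgrPdist_le => e e0.
have /cvgrPdist_le/(_ e e0) : y @[y --> x] --> x by exact: cvg_id.
apply: filterS => y; apply: le_trans.
suff -> : c0_inj x - c0_inj y = c0_inj (x - y) by exact: norm_c0_inj.
by rewrite addrC -scaleN1r -c0_injP scaleN1r addrC.
Qed.

Let dual_restr_pred n f : f \o @c0_inj n \in @dual_pred R (X n).
Proof.
apply/asboolP; split => [a x y|x] /=; first by rewrite c0_injP (dualP f).1.
by apply: continuous_comp; [exact: c0_inj_continuous|exact: (dualP f).2].
Qed.

Definition dual_restr n f : dual (X n) := Dual (@dual_restr_pred n f).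

Lemma dual_sum_inj (x : forall n, X n) k f :
  f (\sum_(n < k) c0_inj (x n)) = \sum_(n < k) dual_restr n f (x n).
Proof. exact: (dual_fun_sum f (fun n => c0_inj (x n))). Qed.

Lemma dual_restrB n f g :
  dual_restr n (f - g) = dual_restr n f - dual_restr n g.
Proof. exact/val_inj. Qed.

Lemma dual_restr_continuous n :
  continuous (dual_restr n : weak_star (c0_sum X) -> weak_star (X n)).
Proof.
apply: continuous_weak_star => x; exact: weak_star_eval_continuous.
Qed.

(** Almost norming vectors for the first [k] coordinates combine into one vector of norm at most 1,
    the norm being a supremum. *)
Lemma sum_norm_dual_restr k f : \sum_(n < k) `|dual_restr n f| <= `|f|.
Proof.
apply/ler_addgt0Pr => e e0.
have ek : 0 < e / k.+1%:R by rewrite divr_gt0.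
have /(_ _)/cid2-/all_sig2[x x1 fx] := dual_norm_approx (dual_restr _ f) ek.
have : f (\sum_(n < k) c0_inj (x n)) <= `|f|.
  rewrite (le_trans (ler_norm _))// (le_trans (dual_ler_norm _ _))//.
  rewrite -[leRHS]mulr1 ler_wpM2l//; apply: c0_norm_le => n.
  rewrite c0_sum_inj; case: ifP => [_|_]; [exact: x1|].
  by rewrite (@normr0 _ (X n)).
rewrite dual_sum_inj => /(lerD (lexx e)).
rewrite [in leRHS]addrC; apply: le_trans.
apply: (@le_trans _ _ (\sum_(n < k) (dual_restr n f (x n) + e / k.+1%:R))).
  by apply: ler_sum => n _; rewrite -lerBlDr ltW.
rewrite big_split/= addrC lerD2r sumr_const card_ord -(mulr_natr (e / _)).
by rewrite mulrAC ler_pdivrMr// ler_wpM2l ?ler_nat// ltW.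
Qed.

(** Truncations approximate a vector of the c0-sum in norm, and on them the partial sums control
    [f]. *)
Lemma dual_c0_sum_norm_le f A :
  (forall k, \sum_(n < k) `|dual_restr n f| <= A) -> `|f| <= A.
Proof.
move=> fA; apply: dual_norm_le => x x1; apply/ler_addgt0Pr => e e0.
have ef : 0 < e / (`|f| + 1) by rewrite divr_gt0// ltr_wpDl.
have /cvgrPdist_le/(_ _ ef)[k _ xk] := c0_cvg0 x.
pose y : c0_sum X := \sum_(n < k) c0_inj (x n).
have fy : `|f y| <= A.
  rewrite (le_trans _ (fA k))// dual_sum_inj.
  rewrite (le_trans (ler_norm_sum _ _ _))//; apply: ler_sum => n _.
  rewrite (le_trans (dual_ler_norm _ _))// -[leRHS]mulr1.
  by rewrite ler_wpM2l// (le_trans _ x1)// c0_norm_ub.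
have xy : `|x - y| <= e / (`|f| + 1).
  apply: c0_norm_le => n; rewrite (_ : (x - y) n = x n - y n)// c0_sum_inj.
  case: ltnP => [_|kn]; first by rewrite subrr normr0 ltW.
  by have := xk n kn; rewrite sub0r normrN normr_id subr0.
rewrite -(subrK y x) dual_funD addrC (le_trans (ler_normD _ _))// lerD//.
rewrite (le_trans (dual_ler_norm _ _))// (le_trans (ler_wpM2l _ xy))//.
by rewrite mulrA ler_pdivrMr ?ltr_wpDl// mulrC ler_pM2l// lerDl.
Qed.

End c0_sum_dual.

(** * The sum of the coordinate potentials *)

Lemma sum_half_pow_le (R : realType) (d : R) k : 0 <= d ->
  \sum_(n < k) d / 2 ^+ n.+1 <= d.
Proof.
move=> d0; suff -> : \sum_(n < k) d / 2 ^+ n.+1 = d - d / 2 ^+ k.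
  by rewrite gerBl divr_ge0// exprn_ge0.
elim: k => [|k ih]; first by rewrite big_ord0 expr0 divr1 subrr.
by rewrite big_ord_recr/= ih exprS; field; rewrite expf_neq0.
Qed.

Section c0_potential.
Context {R : realType} (X : nat -> completeNormedModType R) (M : nat) (d : R).
Hypotheses (XM : forall n, summable_szlenk_with (X n) M%:R) (d0 : 0 < d).

Lemma norm_dual_restr n (f : dual (c0_sum X)) : `|dual_restr n f| <= `|f|.
Proof.
apply: le_trans (sum_norm_dual_restr n.+1 f).
by rewrite big_ord_recr/= lerDr sumr_ge0.
Qed.

(** The error [3 * d] adds up the coordinate errors, the truncation of [P f] at [k], and the
    contribution of [f] beyond [k]. *)
Lemma c0_szlenk_potential : exists P : dual (c0_sum X) -> R,
  [/\ forall f, 0 <= P f,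
      forall f, P f <= M.+1%:R * (`|f| + d) &
      forall f r, \forall g \near (f : weak_star (c0_sum X)),
        `|g : dual (c0_sum X)| <= r ->
        P f + `|(g : dual (c0_sum X)) - f| <= P g + 3 * d].
Proof.
(* Geometric weights keep the total of the coordinate errors at most [d]. *)
pose dn n : R := d / 2 ^+ n.+1.
have dn0 n : 0 < dn n by rewrite divr_gt0// exprn_gt0.
have /(_ _)/cid-/all_sig[Q QP] n := szlenk_potential (@XM n) (dn0 n).
pose S k f := \sum_(n < k) Q n (dual_restr n f).
have S_le k f : S k f <= M.+1%:R * (`|f| + d).
  apply: (@le_trans _ _ (\sum_(n < k) M.+1%:R * (`|dual_restr n f| + dn n))).
    by apply: ler_sum => n _; case: (QP n).
  rewrite -mulr_sumr ler_wpM2l// big_split lerD ?sum_norm_dual_restr//.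
  exact: sum_half_pow_le (ltW d0).
have S_sup f : has_sup (range (S ^~ f)).
  split; first by exists (S 0%N f), 0%N.
  by exists (M.+1%:R * (`|f| + d)) => _ [k _ <-].
(* The terms are nonnegative, so this supremum is the sum of the series. *)
pose P f := sup (range (S ^~ f)).
have SP k f : S k f <= P f by apply: ub_le_sup; [case: (S_sup f)|exists k].
exists P; split => [f|f|f r].
- by apply: le_trans (SP 0%N f); rewrite /S big_ord0.
- by apply: ge_sup; [case: (S_sup f)|move=> _ [k _ <-]].
(* Beyond [k] the coordinates of [f] contribute less than [d] to [P f]. *)
have [_ [k _ <-] Pk] := sup_adherent d0 (S_sup f); rewrite -/(P f) in Pk.
pose E (n : 'I_k) (g : dual (c0_sum X)) := `|dual_restr n g| <= r ->
  Q n (dual_restr n f) + `|dual_restr n g - dual_restr n f|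
    <= Q n (dual_restr n g) + dn n.
have En n : \forall g \near (f : weak_star (c0_sum X)), E n g.
  have [_ _ /(_ (dual_restr n f) r)] := QP n.
  exact: (@dual_restr_continuous _ _ n f).
have FF : Filter (nbhs (f : weak_star (c0_sum X))).
  exact: nbhs_filter (f : weak_star (c0_sum X)).
have := @filter_forall (weak_star (c0_sum X)) _ _ _ FF En.
apply: filterS => g {En}Eg gr.
have gnr n : `|dual_restr n g| <= r by apply: le_trans (norm_dual_restr n g) gr.
rewrite addrC -lerBrDr; apply: dual_c0_sum_norm_le => K.
pose H j := \sum_(n < j) `|dual_restr n (g - f)|.
(* Further coordinates only enlarge the sum, and this ensures that the first [k] are included. *)
have H_le : H K <= H (k + K)%N.
  by rewrite addnC /H big_split_ord/= lerDl sumr_ge0.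
apply: le_trans H_le _.
(* The first [k] coordinates obey [E]; beyond them the norm of the difference is at most the sum of
   the two norms, hence of the two potentials. *)
have HS : S k f + H (k + K)%N
    <= S (k + K)%N g + \sum_(n < k + K) dn n + (S (k + K)%N f - S k f).
  elim: (K) => [|j ih].
    rewrite addn0 subrr addr0 /S /H -!big_split/=; apply: ler_sum => n _.
    by rewrite dual_restrB; exact: Eg.
  rewrite addnS /S /H !big_ord_recr /= -/(S _ _) -/(H _) -/(S _ _) -/(S _ _).
  have [Qf _ _] := QP (k + j)%N.
  have := Qf (dual_restr (k + j) f); have := Qf (dual_restr (k + j) g).
  have := ler_normB (dual_restr (k + j) g) (dual_restr (k + j) f).
  rewrite -dual_restrB; have := dn0 (k + j)%N; lra.
have := SP (k + K)%N f; have := SP (k + K)%N g.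
have := sum_half_pow_le (k + K) (ltW d0); rewrite -/dn.
lra.
Qed.

End c0_potential.

(** * Bounding the sum of the parameters *)

Theorem theorem13 (R : realType) (X : nat -> completeNormedModType R) :
  uniformly_summable_szlenk X -> summable_szlenk (c0_sum X).
Proof.
(* The costs are integers, so the constant is rounded up to a natural number. *)
move=> [M0 XM0]; pose M := (Num.truncn M0).+1.
have XM n : summable_szlenk_with (X n) M%:R.
  move=> k eps k0 eps0 /(XM0 n k eps k0 eps0)/le_trans; apply.
  exact/ltW/truncnS_gt.
(* Half the sum is at most [M.+1 * (1 + d)], the bound for [P] on the ball, plus a total loss of 3;
   and [d <= 1]. *)
exists (4 * M.+1%:R + 6) => k eps _ _ [f feps].
(* Each of the [k] derivations loses [3 * d], so the total loss stays below 3 whatever [k] is. *)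
pose d : R := k.+1%:R^-1.
have d0 : 0 < d by rewrite invr_gt0.
have [P [P0 P_le P_near]] := c0_szlenk_potential XM d0.
have iterP s g : iter_szlenk (@dual_unit_ball R (c0_sum X)) s g ->
    P g + (\sum_(e <- s) e) / 2 <= M.+1%:R * (1 + d) + (size s)%:R * (3 * d).
  elim: s g => [|e s ih] g /=.
    rewrite big_nil mul0r mul0r !addr0 => g1; apply: le_trans (P_le g) _.
    by rewrite ler_wpM2l// lerD2r.
  (* Undoing one derivation leads to a nearby [h] in the ball whose potential is larger by at least
     [e / 2], up to [3 * d]. *)
  move=> /szlenk_derivation_far/(_ (P_near g 1))[h [hs gh egh]].
  have := gh (iter_szlenk_subset hs); have := ih h hs.
  rewrite big_cons -(natr1 (size s)); lra.
have := iterP _ _ feps; rewrite size_tuple big_tuple.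
have := P0 f.
have d1 : d <= 1 by rewrite invf_le1// ler1n.
have kd : k%:R * d <= 1 by rewrite ler_pdivrMr// mul1r ler_nat.
have Md : M.+1%:R * d <= M.+1%:R by rewrite ler_piMr.
rewrite mulrCA mulrDr mulr1; lra.
Qed.
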